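(* Let $S$ be a finite regular semigroup. (i) $S$ is completely regular if and only if the function $f(x)=x^{\omega-1}$ $(x\in S)$ is a permutation matching of $S$. (ii) $S$ is completely simple if and only if the rule $f(x)=x^{\omega-1}(xyx)^{\omega}$ $(x,y\in S)$ defines a permutation matching of $S$ (that is, the value $x^{\omega-1}(xyx)^{\omega}$ depends only on $x$ and not on $y\in S$, and the resulting function $f:S\to S$ is a permutation matching). (iii) $S$ is a group if and only if the rule $f(x)=y^{\omega}x^{\omega-1}y^{\omega}$ $(x,y\in S)$ defines a permutation matching of $S$ (that is, the value $y^{\omega}x^{\omega-1}y^{\omega}$ depends only on $x$ and not on $y\in S$, and the resulting function $f:S\to S$ is a permutation matching). (iv) For each integer $k\geq 1$: $S$ satisfies $x=x^{k+2}$ for all $x\in S$ if and only if $f(x)=x^{k}$ $(x\in S)$ is a permutation matching of $S$; in particular, $S$ is co-regular if and only if the identity function on $S$ is a permutation matching. (v) $S$ is a rectangular band if and only if every permutation of $S$ is a permutation matching.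
   Context: Semigroups are non-empty. For $a\in S$, $V(a)=\{b\in S: aba=a,\ bab=b\}$; $S$ is regular if $V(a)\ne\emptyset$ for all $a$. A permutation matching of a regular semigroup $S$ is a bijection $f:S\to S$ with $f(a)\in V(a)$ for all $a\in S$. For $S$ finite and $a\in S$, $a^{\omega}$ denotes the unique idempotent power of $a$, and $a^{\omega-1}$ denotes the least positive power $a^{k}$ ($k\ge 1$ least) such that $a^{k+1}=a^{\omega}$. A semigroup is completely regular if it is a union of groups. An element $a\in S$ is co-regular if there exists $b\in S$ with $a=aba=bab$, and $S$ is co-regular if all its elements are. A rectangular band is a semigroup satisfying $xyx=x$ for all $x,y$. *)

(* Defs.v *)
From HB Require Import structures.
From mathcomp Require Import all_boot.

Set Implicit Arguments.
Unset Strict Implicit.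
Unset Printing Implicit Defensive.

Local Open Scope group_scope.

#[short(type="finSemigroupType")]
HB.structure Definition FinSemigroup := {S of Semigroup S & Finite S}.

(* The library's [natexp] needs a unit.  Here [pow x n] is x^n for 1 <= n, and
   [pow x 0] has the irrelevant value x. *)
Definition pow (S : semigroupType) (x : S) (n : nat) : S := iterop n *%g x x.
Arguments pow : simpl never.

Section Powers.
Variable S : semigroupType.
Implicit Types x : S.

Lemma powSS x n : pow x n.+2 = x * pow x n.+1.
Proof. by []. Qed.

Lemma powD x m n : 0 < m -> 0 < n -> pow x (m + n) = pow x m * pow x n.
Proof.
case: m n => // m [] // n _ _; elim: m => [|m IHm]; first by rewrite add1n.
by rewrite addSn addnS powSS -addnS IHm powSS mulgA.
Qed.

Lemma pow_idem x n : x * x = x -> 0 < n -> pow x n = x.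
Proof. by move=> xx; elim: n => [|[|n] IHn] // _; rewrite powSS IHn. Qed.

Lemma powM x m n : 0 < m -> 0 < n -> pow x (m * n) = pow (pow x m) n.
Proof.
move=> m0; elim: n => [|[|n] IHn] // _; first by rewrite muln1.
by rewrite mulnS powD ?muln_gt0 ?m0 // IHn // powSS.
Qed.

Lemma pow_idem_unique x m n : 0 < m -> 0 < n ->
    pow x m * pow x m = pow x m -> pow x n * pow x n = pow x n ->
  pow x m = pow x n.
Proof.
move=> m0 n0 im in_.
by rewrite -(pow_idem im n0) -powM // mulnC powM // pow_idem.
Qed.

End Powers.

Section Semigroups.
Variable S : finSemigroupType.
Implicit Types (a b e x y : S) (f : S -> S) (G I : {set S}).

Definition idem e : bool := e * e == e.

Lemma ex_idem_pow a : exists n, (0 < n) && idem (pow a n).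
Proof.
have /injectivePn [i [j ne_ij eq_ij]] :
    ~~ injectiveb (fun i : 'I_#|S|.+1 => pow a i.+1).
  by apply/negP => /injectiveP /leq_card; rewrite card_ord ltnn.
wlog lt_ij : i j ne_ij eq_ij / i < j.
  move=> W; case: (ltngtP i j) => [|lt|/val_inj eq]; first exact: W.
    by apply: (W j i) => //; rewrite eq_sym.
  by rewrite eq eqxx in ne_ij.
pose p := j - i; have p0 : 0 < p by rewrite subn_gt0.
have ipj : i.+1 + p = j.+1 by rewrite addSn subnKC // ltnW.
have step n : i < n -> pow a (n + p) = pow a n.
  move=> lt_in; have [->|ne] := eqVneq n i.+1.
    by rewrite ipj -eq_ij.
  have d0 : 0 < n - i.+1 by rewrite subn_gt0 ltn_neqAle eq_sym ne.
  by rewrite -(subnKC lt_in) addnAC ipj !powD // eq_ij.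
have steps k n : i < n -> pow a (n + k * p) = pow a n.
  elim: k n => [|k IHk] n lt_in; first by rewrite addn0.
  by rewrite mulSn addnA IHk ?step // ltn_addr.
exists (i.+1 * p)%N; rewrite muln_gt0 p0 /=; apply/eqP.
by rewrite -powD ?muln_gt0 ?p0 // steps // leq_pmulr.
Qed.

(* x^omega; by [pow_idem_unique] the choice of exponent is irrelevant. *)
Definition omega a : S := pow a (ex_minn (ex_idem_pow a)).

Lemma omegaP a : exists2 n, 0 < n & omega a = pow a n /\ idem (omega a).
Proof.
by rewrite /omega; case: ex_minnP => n /andP[n0 idn] _; exists n.
Qed.

Lemma omega_unique a n : 0 < n -> idem (pow a n) -> omega a = pow a n.
Proof.
move=> n0 /eqP idn; have [m m0 [E /eqP]] := omegaP a.
by rewrite E => idm; apply: pow_idem_unique.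
Qed.

Lemma ex_omega_pred a : exists k, (0 < k) && (pow a k.+1 == omega a).
Proof.
have [n n0 [E /eqP idn]] := omegaP a.
exists (n + n).-1; rewrite prednK ?addn_gt0 ?n0 //.
by rewrite powD // -E idn eqxx -ltnS prednK ?addn_gt0 ?n0 // -addn1 leq_add.
Qed.

(* x^(omega-1) *)
Definition omega_pred a : S := pow a (ex_minn (ex_omega_pred a)).

Definition V a : {set S} := [set b | (a * b * a == a) && (b * a * b == b)].

Definition permutation_matching f : Prop :=
  bijective f /\ forall a, f a \in V a.

(* The rule f(x) = F x y is a well-defined function of x alone, and that
   function is a permutation matching. *)
Definition defines_permutation_matching (F : S -> S -> S) : Prop :=
  exists f, (forall x y, F x y = f x) /\ permutation_matching f.

(* G is a group under the multiplication of S; its identity need not be an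
   identity of S. *)
Definition is_subgroup G : Prop :=
  mulg_closed G /\
  exists2 e, e \in G &
    forall x, x \in G ->
      [/\ e * x = x, x * e = x &
          exists2 y, y \in G & x * y = e /\ y * x = e].

Definition two_sided_ideal I : Prop :=
  I != set0 /\ forall x s, x \in I -> s * x \in I /\ x * s \in I.

(* Minimal idempotent for the order f <= e iff e * f = f * e = f. *)
Definition primitive_idempotent e : Prop :=
  idem e /\ forall f : S, idem f -> e * f = f -> f * e = f -> f = e.

End Semigroups.

Section Classes.
Variable S : finSemigroupType.

Definition regular_semigroup : Prop := forall a : S, V a != set0.

Definition is_group : Prop := is_subgroup [set: S].

Definition completely_regular : Prop :=
  exists2 P : {set {set S}},
    (forall G, G \in P -> is_subgroup G) & cover P = [set: S].

Definition simple_semigroup : Prop :=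
  forall I : {set S}, two_sided_ideal I -> I = [set: S].

Definition completely_simple : Prop :=
  simple_semigroup /\ exists e : S, primitive_idempotent e.

Definition co_regular : Prop :=
  forall a : S, exists b : S, a = a * b * a /\ a = b * a * b.

Definition rectangular_band : Prop := forall x y : S, x * y * x = x.

End Classes.

(* Main.v *)
(* Everything reduces to the identity [omega x * x = x], which characterises
   complete regularity and makes omega_pred inversion in the maximal subgroups.
   A finite simple semigroup satisfies it because [x = u (x y x) v] can be
   iterated until the outer factors become idempotent, giving
   [x = (x y x) s] and hence [omega (x y x) = omega x].
   Conversely, idempotents e, g inserted in the rules of (ii) and (iii) show
   that every idempotent is primitive, respectively that there is only one. *)
Require Import Defs.
From mathcomp Require Import all_boot.

From mathcomp Require Import zify.

Set Implicit Arguments.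
Unset Strict Implicit.
Unset Printing Implicit Defensive.

Local Open Scope group_scope.

(** * Powers in a semigroup *)

Section PowerLemmas.
Variable S : semigroupType.
Implicit Types e x y u v : S.

Lemma powS x n : 0 < n -> pow x n.+1 = x * pow x n.
Proof. by case: n. Qed.

Lemma powSr x n : 0 < n -> pow x n.+1 = pow x n * x.
Proof. by move=> n0; rewrite -addn1 powD. Qed.

Lemma mulg_pow_id e x n : 0 < n -> e * x = x -> e * pow x n = pow x n.
Proof. by case: n => [|[|n]] // _ ex; rewrite powSS mulgA ex. Qed.

Lemma pow_mulg_id e x n : 0 < n -> x * e = x -> pow x n * e = pow x n.
Proof. by case: n => [|[|n]] // _ xe; rewrite powSr // -mulgA xe. Qed.

(** The innermost pair [u], [v] around [x] is absorbed at each step of the induction. *)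
Lemma pow_sandwich u x v n : 0 < n -> u * x * v = x -> pow u n * x * pow v n = x.
Proof.
case: n => // n _ uxv; elim: n => [|n IHn] //.
by rewrite powSr // powSS -!mulgA (mulgA x) (mulgA u) (mulgA u) uxv mulgA.
Qed.

Lemma pow_period k x m : 0 < k -> x = pow x k.+1 -> pow x (m * k).+1 = x.
Proof.
move=> k0 xk; elim: m => [|m IHm] //.
by rewrite mulSn -addnS powD // IHm -powSr.
Qed.

End PowerLemmas.

(** * Idempotent powers and the pseudo-inverse [omega_pred] *)

Section Omega.
Variable S : finSemigroupType.
Implicit Types e g x y z : S.

Lemma omega_idem x : omega x * omega x = omega x.
Proof. by have [n _ [_ /eqP]] := omegaP x. Qed.

Lemma omega_id e : e * e = e -> omega e = e.
Proof. by move=> ee; apply: (@omega_unique _ e 1) => //; apply/eqP. Qed.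

Lemma omega_pow x n : 0 < n -> omega (pow x n) = omega x.
Proof.
move=> n0; have [m m0 [E /eqP]] := omegaP (pow x n).
rewrite E -powM // => idx; apply/esym/omega_unique; first by rewrite muln_gt0 n0.
exact/eqP.
Qed.

Lemma omega_predP x :
  exists2 k, 0 < k & omega_pred x = pow x k /\ pow x k.+1 = omega x.
Proof.
by rewrite /omega_pred; case: ex_minnP => k /andP[k0 /eqP E] _; exists k.
Qed.

Lemma mul_omega_pred x : x * omega_pred x = omega x.
Proof. by have [k k0 [-> <-]] := omega_predP x; rewrite powS. Qed.

Lemma omega_pred_mul x : omega_pred x * x = omega x.
Proof. by have [k k0 [-> <-]] := omega_predP x; rewrite powSr. Qed.

Lemma omega_pred_id e : e * e = e -> omega_pred e = e.
Proof. by move=> ee; have [k k0 [-> _]] := omega_predP e; rewrite pow_idem. Qed.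

Lemma omega_omega_pred x : omega (omega_pred x) = omega x.
Proof. by have [k k0 [-> _]] := omega_predP x; rewrite omega_pow. Qed.

Lemma omega_comm x : omega x * x = x * omega x.
Proof. by have [n n0 [-> _]] := omegaP x; rewrite -powSr // powS. Qed.

Lemma mulg_omega_id e x : e * x = x -> e * omega x = omega x.
Proof. by have [n n0 [-> _]] := omegaP x; apply: mulg_pow_id. Qed.

Lemma omega_mulg_id e x : x * e = x -> omega x * e = omega x.
Proof. by have [n n0 [-> _]] := omegaP x; apply: pow_mulg_id. Qed.

Lemma omega_pred_mulg_id e x : x * e = x -> omega_pred x * e = omega_pred x.
Proof. by have [k k0 [-> _]] := omega_predP x; apply: pow_mulg_id. Qed.

(** * Matchings by inversion, and complete regularity *)

Lemma mem_VP x y : reflect (x * y * x = x /\ y * x * y = y) (y \in V x).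
Proof.
by rewrite inE; apply: (iffP andP) => -[] => [/eqP-> /eqP->|-> ->].
Qed.

Lemma omega_pred_matching :
  (forall x, omega x * x = x) ->
  permutation_matching (fun x : S => omega_pred x).
Proof.
move=> cr.
have cr' x : x * omega x = x by rewrite -omega_comm.
have fE x : omega_pred x * omega x = omega_pred x by exact: omega_pred_mulg_id.
split; last first.
  move=> x; apply/mem_VP; split; first by rewrite mul_omega_pred.
  by rewrite -mulgA mul_omega_pred.
(* With f = [omega_pred], f is an involution: f(f(x)) = f(f(x)) f(x) x = [omega x * x] = x. *)
apply: inv_bij => x; rewrite -[LHS]fE !omega_omega_pred -omega_pred_mul mulgA.
by rewrite omega_pred_mul omega_omega_pred.
Qed.

(** The power [omega x] stays in [G], and the only idempotent of a group is its identity. *)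
Lemma subgroup_omega (G : {set S}) x :
  is_subgroup G -> x \in G -> omega x * x = x.
Proof.
move=> [Gmul [e _ Ge]] Gx.
suff -> : omega x = e by have [] := Ge x Gx.
have Gw : omega x \in G.
  have [n n0 [-> _]] := omegaP x.
  by case: n n0 => // n _; elim: n => // n IHn; rewrite powSS; apply: Gmul.
have [ew _ [y _ [_ yw]]] := Ge _ Gw.
by rewrite -ew -yw -mulgA omega_idem.
Qed.

(** For idempotent [e] this is the group of units of the local monoid eSe. The inverse [z] may be
    any element of [S], which makes membership easy to prove. *)
Definition maximal_subgroup e : {set S} :=
  [set y | [&& e * y == y, y * e == y &
            [exists z, (y * z == e) && (z * y == e)]]].

Lemma maximal_subgroupP e y :
  reflect [/\ e * y = y, y * e = y & exists z, y * z = e /\ z * y = e]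
    (y \in maximal_subgroup e).
Proof.
rewrite inE; apply: (iffP and3P) => -[].
  by move=> /eqP ey /eqP ye /existsP[z /andP[/eqP yz /eqP zy]]; split=> //; exists z.
move=> ey ye [z [yz zy]]; rewrite ey ye; split=> //.
by apply/existsP; exists z; rewrite yz zy !eqxx.
Qed.

Lemma maximal_subgroup_is_subgroup e :
  e * e = e -> is_subgroup (maximal_subgroup e).
Proof.
move=> ee; split.
  move=> x y /maximal_subgroupP[ex xe [x' [xx' x'x]]].
  move=> /maximal_subgroupP[ey ye [y' [yy' y'y]]].
  apply/maximal_subgroupP; split; rewrite ?mulgA ?ex // -?mulgA ?ye //.
  exists (y' * x'); split.
    by rewrite -mulgA (mulgA y) yy' mulgA xe.
  by rewrite -mulgA (mulgA x') x'x ey.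
exists e; first by apply/maximal_subgroupP; split=> //; exists e.
move=> x /maximal_subgroupP[ex xe [z [xz zx]]]; split=> //.
(* The inverse [z] may lie outside the subgroup; its compression eze lies inside and is still an
   inverse. *)
have xz' : x * (e * z * e) = e by rewrite !mulgA xe xz ee.
have z'x : e * z * e * x = e by rewrite -!mulgA ex zx ee.
exists (e * z * e) => //; apply/maximal_subgroupP; split.
- by rewrite !mulgA ee.
- by rewrite -!mulgA ee.
- by exists x.
Qed.

(** Conversely, each [x] lies in the maximal subgroup at [omega x], with [omega_pred x] as an
    inverse. *)
Lemma completely_regularP :
  completely_regular S <-> forall x : S, omega x * x = x.
Proof.
split=> [[P subP covP] x | cr].
  have : x \in cover P by rewrite covP inE.
  by case/bigcupP=> G PG Gx; apply: subgroup_omega (subP G PG) Gx.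
exists [set maximal_subgroup (omega x) | x : S].
  by move=> _ /imsetP[x _ ->]; apply/maximal_subgroup_is_subgroup/omega_idem.
apply/setP=> x; rewrite inE; apply/bigcupP.
exists (maximal_subgroup (omega x)); first exact: imset_f.
apply/maximal_subgroupP; split; rewrite -?omega_comm //.
by exists (omega_pred x); rewrite mul_omega_pred omega_pred_mul.
Qed.

(** * Finite simple semigroups *)

Lemma simple_factor :
  simple_semigroup S -> forall x y, exists u, exists v, x = u * y * v.
Proof.
move=> simS x y; pose I := [set uv.1 * y * uv.2 | uv : S * S].
have /setP/(_ x) : I = [set: S].
  apply: simS; split.
    by apply/set0Pn; exists (x * y * x); apply/imsetP; exists (x, x).
  move=> _ s /imsetP[[u v] _ ->] /=; split; apply/imsetP.
    by exists (s * u, v); rewrite //= !mulgA.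
  by exists (u, v * s); rewrite //= !mulgA.
by rewrite inE => /imsetP[[u v] _ ->]; exists u, v.
Qed.

(** Iterating the sandwich until the power of [p] is idempotent writes [x] as a product ending in
    [omega p]. *)
Lemma sandwich_omegar x u p : u * x * p = x -> x * omega p = x.
Proof.
move=> uxp; have [n n0 [E _]] := omegaP p.
by have sw := pow_sandwich n0 uxp; rewrite -sw -E -!mulgA omega_idem.
Qed.

Lemma sandwich_omegal x u p : p * x * u = x -> omega p * x = x.
Proof.
move=> pxu; have [n n0 [E _]] := omegaP p.
by have sw := pow_sandwich n0 pxu; rewrite -sw -E !mulgA omega_idem.
Qed.

Lemma simple_xyx :
  simple_semigroup S -> forall x y, exists s, x = x * y * x * s.
Proof.
(* Regroup x = u(xyx)v as uxp with p = yxv; then x = x [omega p] = xp [omega_pred p] begins with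
   xyx. *)
move=> simS x y; have [u [v E]] := simple_factor simS x (x * y * x).
set p := y * x * v.
have xp : x * omega p = x.
  by apply: (@sandwich_omegar x u p); apply/esym; rewrite [LHS]E /p !mulgA.
by exists (v * omega_pred p); rewrite -{1}xp -mul_omega_pred /p !mulgA.
Qed.

Lemma simple_omega_mul :
  simple_semigroup S -> forall x, omega x * x = x.
Proof.
move=> simS x; have [s E] := simple_xyx simS x x.
(* Here x = (xx)xs is a sandwich with left factor xx, whose idempotent power is again [omega x]. *)
by rewrite -(omega_pow x (isT : 0 < 2)); apply: (@sandwich_omegal x s).
Qed.

(** With z = xyx, the product [omega z * omega x] equals [omega z] because z ends in x, and equals
    [omega x] because x = zs gives [omega z * x = x]. *)
Lemma simple_omega_xyx :
  simple_semigroup S -> forall x y, omega (x * y * x) = omega x.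
Proof.
move=> simS x y; have cr := simple_omega_mul simS.
have [s E] := simple_xyx simS x y.
set z := x * y * x in E *.
have ze : z * omega x = z by rewrite /z -!mulgA -omega_comm cr.
rewrite -(omega_mulg_id ze); apply: mulg_omega_id.
by rewrite {1}E mulgA cr -E.
Qed.

(** For an idempotent g below e, the rule at x = e gives e when y = e, but g when y = g. *)
Lemma xyx_matching_primitive :
  defines_permutation_matching
    (fun x y : S => omega_pred x * omega (x * y * x)) ->
  forall e : S, idem e -> primitive_idempotent e.
Proof.
move=> [f [fE _]] e /eqP ee; split; first exact/eqP.
move=> g /eqP gg eg ge; have := fE e e; rewrite -(fE e g).
by rewrite eg ge !ee omega_pred_id // !omega_id // ee eg.
Qed.

(** Choosing y in the ideal puts f(x), hence x = x f(x) x, into the ideal. *)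
Lemma xyx_matching_simple :
  defines_permutation_matching
    (fun x y : S => omega_pred x * omega (x * y * x)) ->
  simple_semigroup S.
Proof.
move=> [f [fE [_ Vf]]] I [/set0Pn[y Iy] Iid]; apply/setP=> x; rewrite inE.
have /mem_VP[<- _] := Vf x.
have Iz : x * y * x \in I.
  by have [/(Iid _ x)[]] := Iid y x Iy.
have Iw : omega (x * y * x) \in I.
  by rewrite -mul_omega_pred; have [] := Iid _ (omega_pred (x * y * x)) Iz.
rewrite -(fE x y); have [If _] := Iid _ (omega_pred x) Iw.
have [If' _] := Iid _ x If.
by have [] := Iid _ x If'.
Qed.

Lemma completely_simpleP :
  0 < #|S| ->
  completely_simple S <->
  defines_permutation_matching
    (fun x y : S => omega_pred x * omega (x * y * x)).
Proof.
move=> /card_gt0P[a _]; split=> [[simS _] | def].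
  have cr := simple_omega_mul simS.
  exists (fun x => omega_pred x); split; last exact: omega_pred_matching.
  move=> x y; rewrite simple_omega_xyx // omega_pred_mulg_id //.
  by rewrite -omega_comm.
split; first exact: xyx_matching_simple.
exists (omega a); apply: xyx_matching_primitive => //.
exact/eqP/omega_idem.
Qed.

(** * Groups *)

Lemma is_group_of_unique_idem :
  0 < #|S| -> regular_semigroup S ->
  (forall e g : S, e * e = e -> g * g = g -> e = g) -> is_group S.
Proof.
move=> /card_gt0P[a _] regS uniq; split; first by move=> *; rewrite inE.
exists (omega a) => [|x _]; first by rewrite inE.
have /set0Pn[y /mem_VP[xyx yxy]] := regS x.
(* For y in V(x), both xy and yx are idempotent, so they equal the sole idempotent, which thereby
   acts as identity on x. *)
have xy : x * y = omega a.
  by apply: uniq (omega_idem a); rewrite mulgA xyx.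
have yx : y * x = omega a.
  by apply: uniq (omega_idem a); rewrite mulgA yxy.
by split; [rewrite -xy | rewrite -yx mulgA | exists y; rewrite ?inE].
Qed.

Lemma is_groupP :
  0 < #|S| -> regular_semigroup S ->
  is_group S <->
  defines_permutation_matching
    (fun x y : S => omega y * omega_pred x * omega y).
Proof.
move=> S0 regS; split=> [grS | [f [fE _]]].
  have cr x : omega x * x = x by apply: subgroup_omega grS _; rewrite inE.
  have [_ [e _ Se]] := grS.
  have wE y : omega y = e.
    have [_ ye [z _ [yz _]]] := Se y (in_setT y).
    by rewrite -yz -{2}(cr y) -mulgA yz; have [_ ->] := Se (omega y) (in_setT _).
  exists (fun x => omega_pred x); split; last exact: omega_pred_matching.
  by move=> x y; rewrite wE; have [-> -> _] := Se (omega_pred x) (in_setT _).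
apply: is_group_of_unique_idem => // e g ee gg.
(* For idempotents, the rule at x = a gives a when y = a, and bab when y = b. Using this both ways,
   eg equals e as well as g. *)
have sw (a b : S) : a * a = a -> b * b = b -> b * a * b = a.
  move=> aa bb; have := fE a a; rewrite -(fE a b).
  by rewrite omega_pred_id // !omega_id // !aa.
have eg : e * g = e by rewrite -(sw e g ee gg) -!mulgA gg.
have eg' : e * g = g by rewrite -(sw g e gg ee) !mulgA ee.
by rewrite -eg eg'.
Qed.

(** * Power maps, the identity and arbitrary permutations as matchings *)

Lemma pow_matchingP k :
  0 < k ->
  (forall x : S, x = pow x (k + 2)) <->
  permutation_matching (fun x : S => pow x k).
Proof.
case: k => // k _; rewrite addn2; split=> [xk | [_ Vk] x]; last first.
  by have /mem_VP[E _] := Vk x; rewrite powSr // powS // E.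
have per x m := @pow_period _ k.+2 x m isT (xk x).
split=> [|x].
  apply: (@inv_bij _ (fun x : S => pow x k.+1)) => x.
  (* The map is its own inverse: (k+1)^2 = k(k+2) + 1, and exponents have period k+2. *)
  by rewrite -powM // -[RHS](per x k); congr pow; rewrite !mulnS mulSn; lia.
apply/mem_VP; split; first by rewrite -powS // -powSr // -xk.
rewrite -powSr // -powD //.
(* The exponent 2k+3 is split as (k+3) + k. For k = 0 the second summand vanishes, where [powD]
   fails since [pow x 0] is x, so that case is read off from [xk]. *)
case: k xk per => [|k] xk _; first by rewrite -xk.
by rewrite -addSnnS powD // -xk.
Qed.

Lemma co_regularP : co_regular S <-> permutation_matching (fun x : S => x).
Proof.
split=> [coS | [_ Vid] x]; last first.
  by have /mem_VP[E _] := Vid x; exists x; rewrite E.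
split=> [|x]; first exact: inv_bij.
suff E : x * x * x = x by apply/mem_VP.
have [y [xyx yxy]] := coS x.
(* Substituting yxy for the second factor gives xx = (xyx)y = xy. *)
have -> : x * x = x * y by rewrite {2}yxy !mulgA -xyx.
exact/esym.
Qed.

(** In a rectangular band all elements are mutually inverse. Conversely, the transposition of x and
    y is a matching, which forces xyx = x. *)
Lemma rectangular_bandP :
  rectangular_band S <->
  forall f : S -> S, bijective f -> permutation_matching f.
Proof.
split=> [rb f bij_f | perm x y]; first by split=> // x; apply/mem_VP.
pose f z := if z == x then y else if z == y then x else z.
have f_inv : involutive f.
  move=> z; rewrite /f; have [->|zx] := eqVneq z x.
    by rewrite eqxx; case: eqVneq.
  by have [->|zy] := eqVneq z y; rewrite ?eqxx // (negPf zx) (negPf zy).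
have [_ /(_ x)] := perm f (inv_bij f_inv).
by rewrite /f eqxx => /mem_VP[].
Qed.

End Omega.

Theorem theorem2p1 (S : finSemigroupType) (S_nonempty : 0 < #|S|)
    (S_regular : regular_semigroup S) :
  (* (i) *)
  (completely_regular S <->
     permutation_matching (fun x : S => omega_pred x)) /\
  (* (ii) *)
  (completely_simple S <->
     defines_permutation_matching
       (fun x y : S => omega_pred x * omega (x * y * x))) /\
  (* (iii) *)
  (is_group S <->
     defines_permutation_matching
       (fun x y : S => omega y * omega_pred x * omega y)) /\
  (* (iv) *)
  ((forall k : nat, 1 <= k ->
      ((forall x : S, x = pow x (k + 2)) <->
       permutation_matching (fun x : S => pow x k))) /\
   (co_regular S <-> permutation_matching (fun x : S => x))) /\
  (* (v) *)
  (rectangular_band S <->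
     forall f : S -> S, bijective f -> permutation_matching f).
Proof.
split; first split=> [/completely_regularP|[_ Vf]].
- exact: omega_pred_matching.
(* The matching condition x f(x) x = x is the criterion itself, as x f(x) = [omega x]. *)
- apply/completely_regularP=> x.
  by have /mem_VP[+ _] := Vf x; rewrite mul_omega_pred.
split; first exact: completely_simpleP.
split; first exact: is_groupP.
split; first by split; [exact: pow_matchingP | exact: co_regularP].
exact: rectangular_bandP.
Qed.
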